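(* Let $\triangle A_1A_2A_3$ be a triangle in $\mathbb{R}^2$, and let $\bar B_1,\bar B_2,\bar B_3$ be positive weights and $\bar B_0$ a residual weight such that $$\|\bar B_1\vec u(A_3,A_1)+\bar B_2\vec u(A_3,A_2)\|\le\bar B_3\qquad\text{and}\qquad \bar B_1+\bar B_2=\bar B_3+\bar B_0.$$ Then the solution of the inverse mixed weighted Fermat-Torricelli problem for three non-collinear points in $\mathbb{R}^2$ in the weighted absorbed case (i.e. with $A_0=A_3$ and with $c=\bar B_1+\bar B_2+\bar B_3$) is not unique.
   Context: $\vec u(A_i,A_j)$ denotes the unit vector in the direction from $A_i$ to $A_j$. Inverse mixed weighted Fermat-Torricelli problem in the weighted absorbed case $A_0=A_3$: given $\triangle A_1A_2A_3$ and a constant $c>0$, find positive weights $\bar B_1,\bar B_2,\bar B_3$ with $\bar B_1+\bar B_2+\bar B_3=c$ such that the point $A_3$ minimizes $X\mapsto\sum_{i=1}^3\bar B_i|XA_i|$ over $X\in\mathbb{R}^2$, and such that $\bar B_1+\bar B_2=\bar B_3+\bar B_0$ for a residual weight $\bar B_0>0$ remaining at the point $A_0=A_3$. The value of $\bar B_0$ is not prescribed. The solution is called unique if there is exactly one such triple $(\bar B_1,\bar B_2,\bar B_3)$. *)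

(* Defs.v *)
From mathcomp Require Import all_boot all_order all_algebra.
From mathcomp Require Import reals.

Set Implicit Arguments.
Unset Strict Implicit.
Unset Printing Implicit Defensive.

Import Order.TTheory GRing.Theory Num.Theory.
Local Open Scope ring_scope.

(* Row vectors carry the sup norm in MathComp-Analysis, so the Euclidean norm
   has to be introduced separately. *)
Definition enorm (R : realType) (v : 'rV[R]_2) : R :=
  Num.sqrt (\sum_(i < 2) v 0 i ^+ 2).

Definition edist (R : realType) (P Q : 'rV[R]_2) : R := enorm (Q - P).

(* The value is junk (zero) when P = Q. *)
Definition unit_vector (R : realType) (P Q : 'rV[R]_2) : 'rV[R]_2 :=
  (edist P Q)^-1 *: (Q - P).

Definition noncollinear (R : realType) (A1 A2 A3 : 'rV[R]_2) : bool :=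
  free [:: A2 - A1; A3 - A1].

Definition weighted_dist_sum (R : realType) (A1 A2 A3 : 'rV[R]_2)
    (B1 B2 B3 : R) (X : 'rV[R]_2) : R :=
  B1 * edist X A1 + B2 * edist X A2 + B3 * edist X A3.

Definition weighted_FT_point (R : realType) (A1 A2 A3 : 'rV[R]_2)
    (B1 B2 B3 : R) (P : 'rV[R]_2) : Prop :=
  forall X : 'rV[R]_2,
    weighted_dist_sum A1 A2 A3 B1 B2 B3 P
      <= weighted_dist_sum A1 A2 A3 B1 B2 B3 X.

(* The inverse mixed problem in the absorbed case, where the weighted
   Fermat-Torricelli point A0 is the vertex A3.  The residual weight B0 left at
   A0 is existentially quantified: it is not prescribed by the problem and is
   not part of the solution. *)
Definition inverse_mixed_FT_absorbed (R : realType) (A1 A2 A3 : 'rV[R]_2)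
    (c : R) (B : R * R * R) : Prop :=
  let: (B1, B2, B3) := B in
  [/\ [/\ 0 < B1, 0 < B2 & 0 < B3],
      B1 + B2 + B3 = c,
      weighted_FT_point A1 A2 A3 B1 B2 B3 A3 &
      exists B0 : R, 0 < B0 /\ B1 + B2 = B3 + B0].

(* Main.v *)
Require Import Defs.
From mathcomp Require Import all_boot all_order all_algebra.
From mathcomp Require Import reals.
From mathcomp Require Import ring lra.

Import Order.TTheory GRing.Theory Num.Theory.
Local Open Scope ring_scope.

(** The problem asks only for the inequality
    [|B1 u(A3,A1) + B2 u(A3,A2)| <= B3] (this makes [A3] a minimizer, see
    [absorbed_FT_point]) and for [B3 < B1 + B2] with a fixed total.  Both leave
    room to move weight away from [A1] and [A2] towards [A3]: multiplying
    [B1] and [B2] by the same [t < 1] and giving the weight so removed to [A3]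
    keeps the total, shrinks the left side of the first inequality, enlarges
    its right side, and for [t] near [1] keeps the second, strict, inequality.
    This produces a second solution besides the given one.

    That the inequality suffices for minimality is a convexity argument: each
    function [X |-> |X A_i|] lies above its affine tangent at [A3], whose
    slope is minus the unit vector towards [A_i]; summing the tangents, the
    linear error at [X] is at most [|B1 u1 + B2 u2| |X A3|] by Cauchy-Schwarz,
    and the term [B3 |X A3|] absorbs it. *)

Definition dot {R : realType} (v w : 'rV[R]_2) : R :=
  \sum_(i < 2) v 0 i * w 0 i.

Lemma dotDl (R : realType) (v1 v2 w : 'rV[R]_2) :
  dot (v1 + v2) w = dot v1 w + dot v2 w.
Proof.
by rewrite /dot -big_split; apply: eq_bigr => i _; rewrite mxE mulrDl.
Qed.

Lemma dotDr (R : realType) (v w1 w2 : 'rV[R]_2) :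
  dot v (w1 + w2) = dot v w1 + dot v w2.
Proof.
by rewrite /dot -big_split; apply: eq_bigr => i _; rewrite mxE mulrDr.
Qed.

Lemma dotZr (R : realType) (a : R) (v w : 'rV[R]_2) :
  dot v (a *: w) = a * dot v w.
Proof.
by rewrite /dot mulr_sumr; apply: eq_bigr => i _; rewrite mxE mulrCA.
Qed.

Lemma enorm_ge0 (R : realType) (v : 'rV[R]_2) : 0 <= enorm v.
Proof. exact: sqrtr_ge0. Qed.

Lemma enorm_sqr (R : realType) (v : 'rV[R]_2) : enorm v ^+ 2 = dot v v.
Proof.
rewrite sqr_sqrtr; last by apply: sumr_ge0 => i _; exact: sqr_ge0.
by apply: eq_bigr => i _; rewrite expr2.
Qed.

Lemma enormZ (R : realType) (a : R) (v : 'rV[R]_2) :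
  enorm (a *: v) = `|a| * enorm v.
Proof.
rewrite /enorm -sqrtr_sqr -sqrtrM ?sqr_ge0// mulr_sumr.
by congr Num.sqrt; apply: eq_bigr => i _; rewrite mxE exprMn.
Qed.

Lemma edistC (R : realType) (P Q : 'rV[R]_2) : edist P Q = edist Q P.
Proof. by rewrite /edist -opprB -scaleN1r enormZ normrN1 mul1r. Qed.

Lemma edistxx (R : realType) (P : 'rV[R]_2) : edist P P = 0.
Proof. by rewrite /edist subrr -(scale0r 0) enormZ normr0 mul0r. Qed.

Lemma dot_le_enorm (R : realType) (v w : 'rV[R]_2) :
  dot v w <= enorm v * enorm w.
Proof.
apply: le_trans (ler_norm _) _.
rewrite -ler_sqr ?nnegrE ?mulr_ge0 ?enorm_ge0// exprMn !enorm_sqr real_normK ?num_real//.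
rewrite /dot !big_ord_recl !big_ord0 !addr0.
set a := v _ _; set b := v _ _; set c := w _ _; set d := w _ _.
(* Lagrange's identity: the two sides differ by the square of the determinant. *)
rewrite -subr_ge0; have -> : (a * a + b * b) * (c * c + d * d) - (a * c + b * d) ^+ 2
  = (a * d - b * c) ^+ 2 by ring.
exact: sqr_ge0.
Qed.

(** Only an inequality, because the unit vector from a point to itself is
    zero. *)
Lemma enorm_unit_vector_le1 (R : realType) (P Q : 'rV[R]_2) :
  enorm (unit_vector P Q) <= 1.
Proof.
rewrite enormZ ger0_norm ?invr_ge0 ?enorm_ge0// -/(edist P Q).
by have [->|h] := eqVneq (edist P Q) 0; rewrite ?mulr0// mulVf.
Qed.

Lemma dot_unit_vector (R : realType) (P Q : 'rV[R]_2) :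
  dot (Q - P) (unit_vector P Q) = edist P Q.
Proof.
rewrite dotZr -enorm_sqr -/(edist P Q).
have [->|h] := eqVneq (edist P Q) 0; first by rewrite expr0n mulr0.
by rewrite expr2 mulKf.
Qed.

(** The distance to [A] is a convex function of the point, and this is its
    subgradient inequality at [P]: the slope is minus the unit vector from [P]
    towards [A]. It also holds for [A = P], where zero is a subgradient. *)
Lemma edist_subgradient (R : realType) (A P X : 'rV[R]_2) :
  edist P A <= edist X A + dot (X - P) (unit_vector P A).
Proof.
rewrite -{1}dot_unit_vector.
have -> : A - P = (A - X) + (X - P) by rewrite addrA subrK.
rewrite dotDl lerD2r; apply: le_trans (dot_le_enorm _ _ _) _.
by rewrite ler_piMr ?enorm_ge0// enorm_unit_vector_le1.
Qed.

(** The resultant pull of [A1] and [A2] at [A3] is the steepest rate at which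
    leaving [A3] can shorten the first two terms; a weight [B3] at least as
    large outbalances it. *)
Lemma absorbed_FT_point (R : realType) (A1 A2 A3 : 'rV[R]_2) (B1 B2 B3 : R) :
  0 <= B1 -> 0 <= B2 ->
  enorm (B1 *: unit_vector A3 A1 + B2 *: unit_vector A3 A2) <= B3 ->
  weighted_FT_point A1 A2 A3 B1 B2 B3 A3.
Proof.
move=> B1ge0 B2ge0 pull X; rewrite /weighted_dist_sum edistxx mulr0 addr0.
have t1 := ler_wpM2l B1ge0 (edist_subgradient _ A1 A3 X).
have t2 := ler_wpM2l B2ge0 (edist_subgradient _ A2 A3 X).
have err := dot_le_enorm _ (X - A3)
  (B1 *: unit_vector A3 A1 + B2 *: unit_vector A3 A2).
rewrite dotDr (dotZr _ B1) (dotZr _ B2) in err.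
have := ler_wpM2l (enorm_ge0 _ (X - A3)) pull.
rewrite -/(edist A3 X) (edistC _ A3 X) in err *.
rewrite !mulrDr in t1 t2; lra.
Qed.

(** Reduces the geometric problem to inequalities between the weights. *)
Lemma inverse_mixed_FT_absorbed_intro (R : realType) (A1 A2 A3 : 'rV[R]_2)
    (B1 B2 B3 c : R) :
  0 < B1 -> 0 < B2 -> 0 < B3 -> B1 + B2 + B3 = c -> B3 < B1 + B2 ->
  enorm (B1 *: unit_vector A3 A1 + B2 *: unit_vector A3 A2) <= B3 ->
  inverse_mixed_FT_absorbed A1 A2 A3 c (B1, B2, B3).
Proof.
move=> B1gt0 B2gt0 B3gt0 total residual pull; split=> //.
  by apply: absorbed_FT_point => //; exact: ltW.
by exists (B1 + B2 - B3); split; lra.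
Qed.

(** Sliding weight from [A1] and [A2], in proportion, to [A3]. The lower bound
    on [t] is [B3 + (1 - t) (B1 + B2) < t (B1 + B2)], that is, a positive
    residual weight after the slide. *)
Lemma inverse_mixed_FT_absorbed_slide (R : realType) (A1 A2 A3 : 'rV[R]_2)
    (B1 B2 B3 t : R) :
  0 < B1 -> 0 < B2 -> 0 < B3 -> 0 < t -> t <= 1 ->
  B1 + B2 + B3 < 2 * t * (B1 + B2) ->
  enorm (B1 *: unit_vector A3 A1 + B2 *: unit_vector A3 A2) <= B3 ->
  inverse_mixed_FT_absorbed A1 A2 A3 (B1 + B2 + B3)
    (t * B1, t * B2, B3 + (1 - t) * (B1 + B2)).
Proof.
move=> B1gt0 B2gt0 B3gt0 tgt0 tle1 residual pull.
have moved : 0 <= (1 - t) * (B1 + B2).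
  by rewrite mulr_ge0 ?subr_ge0// addr_ge0 ?ltW.
apply: inverse_mixed_FT_absorbed_intro; rewrite ?mulr_gt0//.
- by lra.
- by ring.
- by lra.
rewrite -!scalerA -scalerDr enormZ gtr0_norm//.
apply: (@le_trans _ _ B3); last by lra.
by apply: le_trans pull; rewrite ler_piMl// enorm_ge0.
Qed.

Theorem proposition5 (R : realType) (A1 A2 A3 : 'rV[R]_2) (B1 B2 B3 B0 : R)
    (htri : noncollinear A1 A2 A3)
    (hB1 : 0 < B1) (hB2 : 0 < B2) (hB3 : 0 < B3) (hB0 : 0 < B0)
    (habs : enorm (B1 *: unit_vector A3 A1 + B2 *: unit_vector A3 A2) <= B3)
    (hbal : B1 + B2 = B3 + B0) :
  (exists B : R * R * R,
      inverse_mixed_FT_absorbed A1 A2 A3 (B1 + B2 + B3) B) /\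
  ~ (exists! B : R * R * R,
      inverse_mixed_FT_absorbed A1 A2 A3 (B1 + B2 + B3) B).
Proof.
have given : inverse_mixed_FT_absorbed A1 A2 A3 (B1 + B2 + B3) (B1, B2, B3).
  by apply: inverse_mixed_FT_absorbed_intro => //; lra.
split; first by exists (B1, B2, B3).
have Sgt0 : 0 < B1 + B2 by rewrite addr_gt0.
(* The slide moves the weight (1 - t) (B1 + B2) = B0 / 4 and lowers the residual
   by twice as much, so half of it remains. *)
pose t := 1 - B0 / 4 / (B1 + B2).
have tS : t * (B1 + B2) = B1 + B2 - B0 / 4.
  by rewrite mulrBl mul1r divfK// gt_eqF.
have tgt0 : 0 < t by rewrite -(pmulr_lgt0 _ Sgt0) tS; lra.
have tlt1 : t < 1 by rewrite -(ltr_pM2r Sgt0) tS; lra.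
have residual : B1 + B2 + B3 < 2 * t * (B1 + B2) by rewrite -mulrA tS; lra.
have slid := inverse_mixed_FT_absorbed_slide _ _ _ _ _ _ _ _
  hB1 hB2 hB3 tgt0 (ltW tlt1) residual habs.
move=> [B [_ uniqB]].
have /(congr1 (fun B => B.1.1)) /= B1E :=
  etrans (esym (uniqB _ given)) (uniqB _ slid).
by have := ltr_pM2r hB1 t 1; rewrite -B1E mul1r ltxx tlt1.
Qed.
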